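(* Let $A\in\mathbb{R}^{d\times n}$ have columns $a_1,\dots,a_n$, let $L_1=\{x\in\mathbb{R}^n:\|x\|_1\le1\}$, and let $f:\mathbb{R}^d\to\mathbb{R}$ be differentiable, convex, $L$-smooth and $\mu$-strongly convex ($\mu>0$) over the $\ell_1$-ball $L_1$. Let $x^\star$ be an optimal solution of $\min_{x\in L_1}f(Ax)$. Then for every $x\in L_1$ and every $i\in\{1,\dots,n\}$, $$|a_i^\top\nabla f(Ax)|+(Ax)^\top\nabla f(Ax)+L\big(\|a_i\|_2+\|Ax\|_2\big)\sqrt{\frac{G_{L_1}(x)}{\mu}}<0\ \Longrightarrow\ x_i^\star=0 ,$$ where $G_{L_1}(x)$ is the Wolfe gap.
   Context: For a bounded constraint set $\mathcal{C}\subset\mathbb{R}^n$ and $x\in\mathcal{C}$, the Wolfe gap is $G_{\mathcal{C}}(x)=\max_{y\in\mathcal{C}}(Ax-Ay)^\top\nabla f(Ax)$. ''$f$ is $L$-smooth (resp. $\mu$-strongly convex) over $\mathcal{C}$'' means that on the image set $\{Ax: x\in\mathcal{C}\}$ the gradient satisfies $\|\nabla f(u)-\nabla f(v)\|_2\le L\|u-v\|_2$ (resp. $f(u)\ge f(v)+\nabla f(v)^\top(u-v)+\frac{\mu}{2}\|u-v\|_2^2$) for all $u,v$ in that image. *)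

(* Defs.v *)
From HB Require Import structures.
From mathcomp Require Import all_boot all_order all_algebra.
From mathcomp Require Import all_classical all_reals all_analysis.

Set Implicit Arguments.
Unset Strict Implicit.
Unset Printing Implicit Defensive.

Import Order.TTheory GRing.Theory Num.Theory.
Import numFieldNormedType.Exports.

Local Open Scope classical_set_scope.
Local Open Scope ring_scope.

Section Defs.
Context {R : realType}.

Definition dot (m : nat) (u v : 'cV[R]_m) : R := (u^T *m v) 0 0.

(* The library norm `|u| on matrices is the max norm (it generates the same
   topology), so the Euclidean and l1 norms are defined separately. *)
Definition norm2 (m : nat) (u : 'cV[R]_m) : R := Num.sqrt (\sum_j u j 0 ^+ 2).

Definition norm1 (m : nat) (u : 'cV[R]_m) : R := \sum_j `|u j 0|.

Definition l1_ball (n : nat) : set 'cV[R]_n := [set x | norm1 x <= 1].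

Definition gradient (d : nat) (f : 'cV[R]_d -> R) (u : 'cV[R]_d) : 'cV[R]_d :=
  \col_j 'D_(delta_mx j 0) f u.

Definition smooth_on (d : nat) (D : set 'cV[R]_d) (L : R)
    (f : 'cV[R]_d -> R) : Prop :=
  forall u v, D u -> D v ->
    norm2 (gradient f u - gradient f v) <= L * norm2 (u - v).

Definition strongly_convex_on (d : nat) (D : set 'cV[R]_d) (mu : R)
    (f : 'cV[R]_d -> R) : Prop :=
  forall u v, D u -> D v ->
    f u >= f v + dot (gradient f v) (u - v) + mu / 2 * norm2 (u - v) ^+ 2.

Definition is_minimizer (T : Type) (C : set T) (g : T -> R) (x : T) : Prop :=
  C x /\ forall y, C y -> g x <= g y.

(* On [l1_ball] the supremum is an attained maximum, see
   [wolfe_gap_l1_ball_max]. *)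
Definition wolfe_gap (d n : nat) (A : 'M[R]_(d, n)) (f : 'cV[R]_d -> R)
    (C : set 'cV[R]_n) (x : 'cV[R]_n) : R :=
  sup [set dot (A *m x - A *m y) (gradient f (A *m x)) | y in C].

Lemma dotE m (u v : 'cV[R]_m) : dot u v = \sum_j u j 0 * v j 0.
Proof. by rewrite /dot mxE; apply: eq_bigr => j _; rewrite mxE. Qed.

(* The maximum is max_j |w_j|, reached at a signed basis vector. *)
Lemma linear_l1_ball_max n (w : 'cV[R]_n) :
  exists2 y, l1_ball y & forall z, l1_ball z -> dot z w <= dot y w.
Proof.
case: n w => [|n] w.
  exists 0; first by rewrite /l1_ball /norm1 /= big_ord0 ler01.
  by move=> z _; rewrite !dotE !big_ord0.
have [k _ kmax] := @arg_maxP _ _ _ (ord0 : 'I_n.+1) predT (fun j => `|w j 0|) isT.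
exists (Num.sg (w k 0) *: delta_mx k 0).
  rewrite /l1_ball /norm1 /= (bigD1 k)//= big1 => [|j jk].
    rewrite !mxE !eqxx mulr1 addr0 normr_sg.
    by case: (w k 0 != 0); rewrite ?lexx ?ler01.
  by rewrite !mxE (negbTE jk) mulr0 normr0.
move=> z; rewrite /l1_ball /norm1 /= => z1.
rewrite [leRHS]dotE (bigD1 k)//= [X in _ + X]big1 => [|j jk]; last first.
  by rewrite !mxE (negbTE jk) mulr0 mul0r.
rewrite !mxE !eqxx mulr1 addr0 -normrEsg dotE.
apply: (@le_trans _ _ (\sum_j `|z j 0| * `|w k 0|)).
  apply: ler_sum => j _; apply: (le_trans (ler_norm _)).
  by rewrite normrM ler_wpM2l//; exact: kmax.
by rewrite -mulr_suml ler_piMl.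
Qed.

Lemma wolfe_gap_l1_ball_max d n (A : 'M[R]_(d, n)) (f : 'cV[R]_d -> R) x :
  exists2 y, l1_ball y &
    wolfe_gap A f (@l1_ball n) x
      = dot (A *m x - A *m y) (gradient f (A *m x)) /\
    forall z, l1_ball z ->
      dot (A *m x - A *m z) (gradient f (A *m x))
        <= dot (A *m x - A *m y) (gradient f (A *m x)).
Proof.
set g := gradient f (A *m x).
have E z : dot (A *m x - A *m z) g = dot (A *m x) g + dot z (- (A^T *m g)).
  rewrite /dot linearB /= mulmxBl mulmxN !trmx_mul !mulmxA.
  by rewrite [LHS]mxE.
have [y y1 ymax] := linear_l1_ball_max (- (A^T *m g)).
have ymax' z : l1_ball z ->
    dot (A *m x - A *m z) g <= dot (A *m x - A *m y) g.
  by move=> z1; rewrite !E lerD2l ymax.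
exists y => //; split=> //; apply/eqP; rewrite eq_le; apply/andP; split.
  apply: ge_sup; first by exists (dot (A *m x - A *m y) g); exists y.
  by move=> _ [z z1 <-]; exact: ymax'.
apply: ub_le_sup; last by exists y.
by exists (dot (A *m x - A *m y) g) => _ [z z1 <-]; exact: ymax'.
Qed.

End Defs.

(* Main.v *)
(* Strong convexity and the Lipschitz gradient give, without differentiating,
   the first-order condition [dot (A y - A xs) g* >= 0], where [g*] is the
   gradient at [A xs].  Adding the two strong convexity inequalities between
   [x] and [xs] yields [mu |A x - A xs|^2 <= G(x)], so the gradient at [A x] is
   within [L sqrt (G(x) / mu)] of [g*], and the hypothesis transfers to [xs]:
   [|dot a_i g*| + dot (A xs) g* < 0].  If [xs_i <> 0], moving the mass of the
   [i]-th coordinate of [xs] onto [xs] itself stays in the ball and contradicts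
   the first-order condition. *)
Require Import Defs.
From HB Require Import structures.
From mathcomp Require Import all_boot all_order all_algebra.
From mathcomp Require Import all_classical all_reals all_analysis.
From mathcomp Require Import ring lra.

Set Implicit Arguments.
Unset Strict Implicit.
Unset Printing Implicit Defensive.

Import Order.TTheory GRing.Theory Num.Theory.
Import numFieldNormedType.Exports.

Local Open Scope classical_set_scope.
Local Open Scope ring_scope.

Section Dot.
Context {R : realType} {m : nat}.
Implicit Types u v w : 'cV[R]_m.

Lemma dotC u v : dot u v = dot v u.
Proof. by rewrite !dotE; apply: eq_bigr => j _; rewrite mulrC. Qed.

Lemma dotDl u v w : dot (u + v) w = dot u w + dot v w.
Proof. by rewrite /dot linearD mulmxDl mxE. Qed.

Lemma dotZl (a : R) u w : dot (a *: u) w = a * dot u w.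
Proof. by rewrite /dot linearZ /= -scalemxAl mxE. Qed.

Lemma dotBl u v w : dot (u - v) w = dot u w - dot v w.
Proof. by rewrite -scaleN1r dotDl dotZl mulN1r. Qed.

Lemma dotBr u v w : dot w (u - v) = dot w u - dot w v.
Proof. by rewrite dotC dotBl !(dotC w). Qed.

Lemma norm2_ge0 u : 0 <= norm2 u.
Proof. exact: sqrtr_ge0. Qed.

Lemma sqr_norm2 u : norm2 u ^+ 2 = dot u u.
Proof.
rewrite dotE sqr_sqrtr; last by apply: sumr_ge0 => j _; exact: sqr_ge0.
by apply: eq_bigr => j _; rewrite expr2.
Qed.

Lemma norm2_eq0 u : norm2 u = 0 -> u = 0.
Proof.
move=> /(congr1 (fun a => a ^+ 2)); rewrite sqr_norm2 dotE expr0n /= => u0.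
apply/colP => j; rewrite mxE; apply/eqP; rewrite -sqrf_eq0 expr2; apply/eqP.
by apply: (psumr_eq0P _ u0) => // k _; rewrite -expr2 sqr_ge0.
Qed.

Lemma dot0l u : dot 0 u = 0.
Proof. by rewrite -(scale0r u) dotZl mul0r. Qed.

Lemma norm2Z (a : R) u : norm2 (a *: u) = `|a| * norm2 u.
Proof.
apply/eqP; rewrite -(@eqrXn2 _ 2) ?norm2_ge0 ?mulr_ge0 ?norm2_ge0 //.
by rewrite exprMn !sqr_norm2 real_normK ?num_real // dotZl dotC dotZl mulrA.
Qed.

Lemma norm2N u : norm2 (- u) = norm2 u.
Proof. by rewrite -scaleN1r norm2Z normrN1 mul1r. Qed.

(** Cauchy-Schwarz: expanding the squared norm of [norm2 v *: u - norm2 u *: v] gives 2 |u| |v| (|u|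
    |v| - u.v) >= 0. Dividing by |u| |v| is why zero vectors are split off. *)
Lemma dot_le_norm2 u v : dot u v <= norm2 u * norm2 v.
Proof.
have [/norm2_eq0 ->|u0] := eqVneq (norm2 u) 0.
  by rewrite dot0l mulr_ge0 ?norm2_ge0.
have [/norm2_eq0 ->|v0] := eqVneq (norm2 v) 0.
  by rewrite dotC dot0l mulr_ge0 ?norm2_ge0.
have uv0 : 0 < norm2 u * norm2 v by rewrite mulr_gt0 // lt_def ?u0 ?v0 norm2_ge0.
have := sqr_ge0 (norm2 (norm2 v *: u - norm2 u *: v)).
rewrite sqr_norm2 dotBl !dotBr !dotZl !(dotC _ (_ *: _)) !dotZl -!sqr_norm2.
rewrite (dotC v u) => h.
rewrite -subr_ge0 -(pmulr_rge0 _ uv0); nra.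
Qed.

Lemma abs_dot_le_norm2 u v : `|dot u v| <= norm2 u * norm2 v.
Proof.
rewrite ler_norml dot_le_norm2 andbT lerNl -mulN1r -dotZl scaleN1r.
by rewrite -[norm2 u]norm2N dot_le_norm2.
Qed.

End Dot.

Section L1Ball.
Context {R : realType} {n : nat}.
Implicit Types x y : 'cV[R]_n.

Lemma l1_ball_segment x y (t : R) :
  0 <= t <= 1 -> l1_ball x -> l1_ball y -> l1_ball (x + t *: (y - x)).
Proof.
rewrite /l1_ball /norm1 /= => /andP[t0 t1] x1 y1.
apply: (@le_trans _ _ ((1 - t) * (\sum_j `|x j 0|) + t * (\sum_j `|y j 0|))).
  rewrite !mulr_sumr -big_split /=; apply: ler_sum => j _; rewrite !mxE.
  have -> : x j 0 + t * (y j 0 - x j 0) = (1 - t) * x j 0 + t * y j 0 by ring.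
  by rewrite (le_trans (ler_normD _ _)) // !normrM (ger0_norm t0) ger0_norm // subr_ge0.
by nra.
Qed.

(** The [i]-th entry becomes [|x_i| x_i] and the others grow by the factor [1 + |x_i|], so the norm
    is |x|_1 - |x_i| + |x_i| |x|_1, at most 1 since |x|_1 <= 1. *)
Lemma l1_ball_shift_mass x (i : 'I_n) :
  l1_ball x -> l1_ball ((1 + `|x i 0|) *: x - x i 0 *: delta_mx i 0).
Proof.
rewrite /l1_ball /norm1 /= => x1.
apply: (@le_trans _ _ (\sum_j `|x j 0| - `|x i 0|
                        + `|x i 0| * \sum_j `|x j 0|)); last first.
  have := normr_ge0 (x i 0); nra.
rewrite (bigD1 i) //= [in leRHS](bigD1 i) //=.
rewrite !mxE !eqxx mulr1 mulrDl mul1r addrAC subrr add0r normrM normr_id.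
rewrite mulrDr [`|x i 0| + _ - _]addrAC subrr add0r addrCA lerD2l.
rewrite mulr_sumr -big_split /=; apply: ler_sum => j ji.
rewrite !mxE (negbTE ji) mulr0 subr0 normrM ger0_norm ?addr_ge0 //.
by rewrite mulrDl mul1r.
Qed.

End L1Ball.

(* Strong convexity between [xs] and [xs + t (y - xs)] makes the directional
   slope nonnegative at the latter point; let [t] tend to 0. *)
Lemma first_order_optimality (R : realType) (d n : nat) (A : 'M[R]_(d, n))
    (f : 'cV[R]_d -> R) (L mu : R) (xs : 'cV[R]_n) :
  smooth_on [set A *m x | x in @l1_ball R n] L f -> 0 < mu ->
  strongly_convex_on [set A *m x | x in @l1_ball R n] mu f ->
  is_minimizer (@l1_ball R n) (fun x => f (A *m x)) xs ->
  forall y, l1_ball y ->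
    0 <= dot (A *m y - A *m xs) (gradient f (A *m xs)).
Proof.
move=> f_smooth mu_gt0 f_strong [xs1 xs_min] y y1.
set w := A *m y - A *m xs; set c := dot _ _.
have slope t : 0 < t <= 1 -> - c <= t * (L * norm2 w ^+ 2).
  move=> /andP[t0 t1]; pose z := xs + t *: (y - xs).
  have z1 : l1_ball z by apply: l1_ball_segment => //; rewrite (ltW t0).
  have Az : A *m z = A *m xs + t *: w.
    by rewrite mulmxDr -scalemxAr mulmxBr.
  have imz : [set A *m x | x in @l1_ball R n] (A *m z) by exists z.
  have imxs : [set A *m x | x in @l1_ball R n] (A *m xs) by exists xs.
  have := f_strong _ _ imxs imz; have := xs_min _ z1; have := f_smooth _ _ imz imxs.
  rewrite (_ : A *m xs - A *m z = (- t) *: w); last first.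
    by rewrite Az opprD addrA subrr add0r scaleNr.
  rewrite (_ : A *m z - A *m xs = t *: w); last by rewrite Az addrAC subrr add0r.
  rewrite dotC dotZl norm2Z gtr0_norm // => lip min_z conv.
  have sq : 0 <= mu / 2 * norm2 (- t *: w) ^+ 2.
    by rewrite mulr_ge0 ?sqr_ge0 // divr_ge0 // ltW.
  have slope_z : 0 <= dot w (gradient f (A *m z)).
    by rewrite -(pmulr_rge0 _ t0); lra.
  (* [- c] is [w] against the gradient difference, minus the nonnegative [slope_z]; Cauchy-Schwarz
     and [lip] bound the first term by t L |w|^2. *)
  have := dot_le_norm2 w (gradient f (A *m z) - gradient f (A *m xs)).
  rewrite dotBr -/c; have := ler_wpM2l (norm2_ge0 w) lip; nra.
rewrite leNgt; apply/negP => c0.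
(* If [c < 0], then [t = 1] gives [- c <= K], so [t = - c / (2 K)] is admissible; there the slope
   bound reads [- c <= - c / 2], which is absurd. *)
set K := L * _ in slope.
have K_ge : - c <= K by have := slope 1; rewrite mul1r; apply; rewrite ltr01 lexx.
have K0 : 0 < K by lra.
have t_in : 0 < - c / (2 * K) <= 1.
  by rewrite divr_gt0 ?ler_pdivrMr; lra.
have := slope _ t_in.
have -> : - c / (2 * K) * K = - c / 2 by field; rewrite gt_eqF.
by lra.
Qed.

Theorem theorem11 (R : realType) (d n : nat) (A : 'M[R]_(d, n))
    (f : 'cV[R]_d -> R) (L mu : R) (xs : 'cV[R]_n)
    (f_diff : forall u : 'cV[R]_d, differentiable f u)
    (f_convex : convex_function [set: convex_lmodType 'cV[R]_d] f)
    (f_smooth : smooth_on [set A *m x | x in @l1_ball R n] L f)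
    (mu_gt0 : 0 < mu)
    (f_strong : strongly_convex_on [set A *m x | x in @l1_ball R n] mu f)
    (xs_opt : is_minimizer (@l1_ball R n) (fun x => f (A *m x)) xs)
    (x : 'cV[R]_n) (x_in : l1_ball x) (i : 'I_n) :
  `|dot (col i A) (gradient f (A *m x))| + dot (A *m x) (gradient f (A *m x))
    + L * (norm2 (col i A) + norm2 (A *m x))
        * Num.sqrt (wolfe_gap A f (@l1_ball R n) x / mu) < 0 ->
  xs i 0 = 0.
Proof.
have foc := first_order_optimality f_smooth mu_gt0 f_strong xs_opt.
have xs1 := xs_opt.1.
have imx : [set A *m x | x in @l1_ball R n] (A *m x) by exists x.
have imxs : [set A *m x | x in @l1_ball R n] (A *m xs) by exists xs.
have [y y1 [gapE gap_max]] := wolfe_gap_l1_ball_max A f x.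
set G := wolfe_gap _ _ _ _ in gapE *.
set g := gradient f (A *m x) in gapE gap_max *.
pose gs := gradient f (A *m xs).
pose r := norm2 (A *m x - A *m xs).
have rG : r <= Num.sqrt (G / mu).
  rewrite -(ler_pXn2r (n := 2)) ?nnegrE ?norm2_ge0 ?sqrtr_ge0 //.
  (* The two inequalities add up to mu r^2 <= (A x - A xs).(g - gs). The [g] part is at most [G]
     because [xs] competes in the maximum; the [gs] part is nonnegative by [foc]. *)
  have gapr : mu * r ^+ 2 <= G.
    have := f_strong _ _ imx imxs; have := f_strong _ _ imxs imx.
    have := foc _ x_in; have := gap_max _ xs1; rewrite -gapE.
    rewrite -[norm2 (A *m xs - _)]norm2N opprB -/g -/gs -/r.
    rewrite !dotBl !dotBr !(dotC g) !(dotC gs); lra.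
  have rr : r ^+ 2 <= G / mu by rewrite ler_pdivlMr // mulrC.
  by rewrite [leRHS]sqr_sqrtr // (le_trans (sqr_ge0 r) rr).
have LrG : L * r <= L * Num.sqrt (G / mu).
  have [L0|L0] := leP 0 L; first by rewrite ler_wpM2l.
  (* A negative [L] forces the image of the ball to be a point. *)
  have Axy : A *m x - A *m y = 0.
    have imy : [set A *m x | x in @l1_ball R n] (A *m y) by exists y.
    apply: norm2_eq0; apply/eqP; rewrite eq_le norm2_ge0 andbT.
    by rewrite -(nmulr_rge0 _ L0) (le_trans _ (f_smooth _ _ imx imy)) ?norm2_ge0.
  have G0 : G = 0 by rewrite gapE Axy dot0l.
  move: rG; rewrite G0 mul0r sqrtr0 => r0.
  by rewrite (_ : r = 0) //; apply/eqP; rewrite eq_le r0 norm2_ge0.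
have lip : norm2 (gs - g) <= L * Num.sqrt (G / mu).
  by rewrite -norm2N opprB (le_trans (f_smooth _ _ imx imxs)).
move=> screen.
(* [foc] at [x] replaces [A xs] by [A x] against [gs]; then passing from [gs] to [g] costs at most
   |a_i| + |A x| times the bound in [lip], exactly the last term of [screen]. *)
have screen_s : `|dot (col i A) gs| + dot (A *m xs) gs < 0.
  have := foc _ x_in; rewrite dotBl -/gs => opt_x.
  have := abs_dot_le_norm2 (col i A) (gs - g).
  have := dot_le_norm2 (A *m x) (gs - g).
  have := ler_wpM2l (norm2_ge0 (A *m x)) lip.
  have := ler_wpM2l (norm2_ge0 (col i A)) lip.
  have := ler_normD (dot (col i A) g) (dot (col i A) (gs - g)).
  rewrite !dotBr [dot (col i A) g + _]addrC subrK; nra.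
apply/eqP; apply/negPn/negP => xi0.
(* The displacement is |xs_i| xs - xs_i e_i, so its slope is at most |xs_i| times the left side of
   [screen_s], hence negative. *)
have := foc _ (l1_ball_shift_mass i xs1).
rewrite mulmxBr -!scalemxAr -colE !dotBl !dotZl -/gs.
have := ler_norm (- (xs i 0 * dot (col i A) gs)).
rewrite normrN normrM.
have : 0 < `|xs i 0| by rewrite normr_gt0.
nra.
Qed.
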